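(* Let $f:\mathbb{R}_+\to\mathbb{R}$. If there exists a constant $M\ge0$ such that the function $g:\mathbb{R}_+\to\mathbb{R}$ defined by $g(t)=f(t)-Mt$ for all $t\ge0$ is non-increasing, then $f$ is quasi-uniformly continuous. In particular, if $f\in C^1(\mathbb{R}_+)$ and there exists $M>0$ such that $\dot f(t)\le M$ for all $t\ge0$, then $f$ is quasi-uniformly continuous.
   Context: $\mathbb{R}_+=[0,+\infty)$. A function $f:\mathbb{R}_+\to\mathbb{R}$ is quasi-uniformly continuous if for every $\varepsilon>0$ there exists $\delta(\varepsilon)>0$ such that $f(t)-f(t_0)<\varepsilon$ for all $t\ge t_0\ge0$ with $t\le t_0+\delta(\varepsilon)$. *)

(* Defs.v *)
From HB Require Import structures.
From mathcomp Require Import all_boot all_order all_algebra.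
From mathcomp Require Import all_classical all_reals all_analysis.

Set Implicit Arguments.
Unset Strict Implicit.
Unset Printing Implicit Defensive.

Import Order.TTheory GRing.Theory Num.Theory.
Import numFieldNormedType.Exports.
Local Open Scope classical_set_scope.
Local Open Scope ring_scope.

(* MathComp-Analysis. A function on R_+ = [0, +oo[ is encoded as a total
   f : R -> R; every notion below depends only on its values on [0, +oo[. *)

Definition quasi_uniformly_continuous (R : realType) (f : R -> R) : Prop :=
  forall eps : R, 0 < eps ->
    exists2 delta : R, 0 < delta &
      forall t0 t : R, 0 <= t0 -> t0 <= t -> t <= t0 + delta ->
        f t - f t0 < eps.

(* The difference quotient is taken along points s != t of [0, +oo[ only, so
   that the derivative at t = 0 is the right derivative. The library's derive1
   would instead involve the values of f at negative points. *)
Definition derivable_Rplus (R : realType) (f : R -> R) (t : R) : Prop :=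
  cvg ((f s - f t) / (s - t) @[s --> within `[0, +oo[ t^']).

(* Meaningful only when derivable_Rplus f t holds. *)
Definition derive_Rplus (R : realType) (f : R -> R) (t : R) : R :=
  lim ((f s - f t) / (s - t) @[s --> within `[0, +oo[ t^']).

Definition C1_Rplus (R : realType) (f : R -> R) : Prop :=
  (forall t : R, 0 <= t -> derivable_Rplus f t) /\
  {within `[0, +oo[, continuous (derive_Rplus f)}.

(* Main.v *)
Require Import Defs.
From HB Require Import structures.
From mathcomp Require Import all_boot all_order all_algebra.
From mathcomp Require Import all_classical all_reals all_analysis.

Set Implicit Arguments.
Unset Strict Implicit.
Unset Printing Implicit Defensive.

Import Order.TTheory GRing.Theory Num.Theory.
Import numFieldNormedType.Exports.
Local Open Scope classical_set_scope.
Local Open Scope ring_scope.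

(* The hypothesis that t |-> f t - M t is non-increasing gives the one-sided
   Lipschitz bound f t - f t0 <= M (t - t0). In the C^1 case that hypothesis
   follows from the mean value theorem on [a, b], which needs the two-sided
   derivative only inside ]a, b[, hence at positive points, where it agrees
   with the derivative relative to [0, +oo[; at a = 0 continuity relative to
   [0, +oo[ suffices. *)

(** For [s != t], [f s] is the difference quotient times [s - t], plus [f t]; the quotient converges
    and [s - t] tends to 0. *)
Lemma derivable_Rplus_continuous (R : realType) (f : R -> R) (t : R) :
  derivable_Rplus f t -> f s @[s --> within `[0, +oo[ (nbhs t)] --> f t.
Proof.
move=> dft.
have ft : f s @[s --> within `[0, +oo[ t^'] --> f t.
  have id_t : s - t @[s --> within `[0, +oo[ t^'] --> (0 : R).
    rewrite -(subrr t); apply: cvgB; last exact: cvg_cst.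
    apply: cvg_trans; first exact: cvg_within.
    exact: cvg_within.
  have := cvgD (cvgM dft id_t) (cvg_cst (f t)).
  rewrite mulr0 add0r => cvg_ft; apply: cvg_trans (cvg_ft _ _ _).
  apply: near_eq_cvg; rewrite !near_withinE; near=> s => st _.
  by rewrite /= [LHS]/GRing.add /= divfK ?subr_eq0 // subrK.
(* The punctured limit becomes a full one: at the missing point [s = t] the distance is 0. *)
apply/cvgrPdist_lt => e e0; move/cvgrPdist_lt : ft => /(_ e e0).
rewrite !near_withinE; apply: filterS => s fs s0.
have [->|st] := eqVneq s t; first by rewrite subrr normr0.
exact: fs.
Unshelve. all: by end_near. Qed.

(** Substitute [s = h + t]: as soon as [- t < h], the point [h + t] lies in the half-line, so the
    restriction on [s] is harmless. *)
Lemma derivable_Rplus_is_derive (R : realType) (f : R -> R) (t : R) :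
  0 < t -> derivable_Rplus f t -> is_derive t 1 f (derive_Rplus f t).
Proof.
move=> t0 dft.
suff ft : h^-1 *: ((f \o shift t) (h *: (1 : R)) - f t) @[h --> 0^']
    --> derive_Rplus f t.
  by split; [apply/cvg_ex; exists (derive_Rplus f t)|exact: cvg_lim].
apply/cvgrPdist_lt => e e0.
move/cvgrPdist_lt : (dft) => /(_ e e0).
rewrite !near_withinE.
have sh : h + t @[h --> (0 : R)] --> t.
  by rewrite -{2}[t]add0r; apply: cvgD; [exact: cvg_id|exact: cvg_cst].
move=> /sh near_t.
have Nt0 : - t < 0 by rewrite oppr_lt0.
apply: filterS2 (lt_nbhsr Nt0) near_t => h ht /= fh h0.
have -> : h^-1 *: (f (h%:A + t) - f t) = (f (h + t) - f t) / (h + t - t).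
  by rewrite addrK mulrC [h%:A]mulr1.
apply: fh; first by rewrite -subr_eq0 addrK.
by rewrite in_itv /= andbT -lerBlDr sub0r ltW.
Qed.

Lemma nonincreasing_quasi_uniformly_continuous (R : realType) (f : R -> R)
    (M : R) : 0 <= M ->
  {in `[0, +oo[ &, nonincreasing_fun (fun t : R => f t - M * t)} ->
  quasi_uniformly_continuous f.
Proof.
move=> M0 fM e e0; have M1 : 0 < M + 1 by rewrite ltr_wpDl.
(* Dividing by [M + 1] allows [M = 0] and makes [M * delta < e] strict. *)
exists (e / (M + 1)); first by rewrite divr_gt0.
move=> t0 t t0_ge0 t0t td.
have := fM t0 t _ _ t0t; rewrite !in_itv /= !andbT => /(_ t0_ge0).
move=> /(_ (le_trans t0_ge0 t0t)); rewrite lerBlDr -addrA -lerBlDl.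
rewrite [leRHS]addrC -mulrBr => /le_lt_trans; apply.
apply: (@le_lt_trans _ _ (M * (e / (M + 1)))).
  by rewrite ler_wpM2l // lerBlDl.
by rewrite mulrCA gtr_pMr // ltr_pdivrMr // mul1r ltrDl.
Qed.

Theorem proposition2 (R : realType) (f : R -> R) :
  ((exists2 M : R, 0 <= M &
      {in `[0, +oo[ &, nonincreasing_fun (fun t : R => f t - M * t)}) ->
    quasi_uniformly_continuous f)
  /\
  (C1_Rplus f ->
   (exists2 M : R, 0 < M & forall t : R, 0 <= t -> derive_Rplus f t <= M) ->
    quasi_uniformly_continuous f).
Proof.
split=> [[M M0]|[df _] [M M0 dfM]].
  exact: nonincreasing_quasi_uniformly_continuous.
apply: (nonincreasing_quasi_uniformly_continuous (ltW M0)) => a b.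
rewrite !in_itv /= !andbT => a0 _ ab.
have xa0 x : x \in `[a, b]%R -> 0 <= x.
  by rewrite in_itv /= => /andP[/(le_trans a0)].
have fab : {within `[a, b], continuous f}.
  apply/subspace_continuousP => x /= /xa0 x0.
  (* Passing from the half-line to the smaller set [[a, b]] only refines the filter. *)
  apply: cvg_trans (derivable_Rplus_continuous (df x x0)).
  apply: cvg_app; apply: within_subset => s /= /xa0.
  by rewrite in_itv /= andbT.
have dfab x : x \in `]a, b[%R -> is_derive x 1 f (derive_Rplus f x).
  rewrite in_itv /= => /andP[/(le_lt_trans a0) x0 _].
  exact: derivable_Rplus_is_derive (df x (ltW x0)).
(* This form covers [a = b]. Here [c] may be an endpoint, but [0 <= c] suffices for the bound by
   [M]. *)
have [c cab fba] := MVT_segment ab dfab fab.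
rewrite lerBlDr -addrA -lerBlDl fba [leRHS]addrC -mulrBr.
by rewrite ler_wpM2r ?subr_ge0// dfM// xa0.
Qed.
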